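(* Let $C_1,\dots,C_T\in\mathbb{R}^{n\times n}$ be symmetric with $0\preceq C_t\preceq I$, $T\ge1$, and let $\mathscr{B}^n_1$ be the set of density matrices. Run the following algorithm: start from $Y_1\in\mathscr{B}^n_1$; at each $t$ eigendecompose $Y_t=\widehat D\mathrm{diag}(\sigma_t)\widehat D^\top$, play the unit vector $\widehat D[:,j]$ with probability $\sigma_{t,j}$, receive $C_t$, and update $V_{t+1}=\frac{\exp(\ln Y_t-\eta C_t)}{\mathrm{Tr}\exp(\ln Y_t-\eta C_t)}=\widehat U\mathrm{diag}(v_{t+1})\widehat U^\top$, $Y_{t+1}=\widehat U\mathrm{diag}(\frac\alpha n+(1-\alpha)v_{t+1})\widehat U^\top$, with $\alpha=\frac1{T+1}$ and $\eta=\frac{\sqrt{\ln(n(1+T))}}{\sqrt T}$. Then $$\max_{[r,s]\subset[1,T]}\Big\{\sum_{t=r}^s\mathrm{Tr}(Y_tC_t)-\min_{U\in\mathscr{B}^n_1}\sum_{t=r}^s\mathrm{Tr}(UC_t)\Big\}\le O\Big(\sqrt{T\ln(n(1+T))}\Big).$$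
   Context: $\ln,\exp$ denote matrix logarithm/exponential. $O(\cdot)$ hides an absolute constant. *)

(* Defs.v *)
From HB Require Import structures.
From mathcomp Require Import all_boot all_order all_algebra.
From mathcomp Require Import all_classical all_reals all_analysis.
Set Implicit Arguments. Unset Strict Implicit. Unset Printing Implicit Defensive.
Import Order.TTheory GRing.Theory Num.Theory.
Import numFieldNormedType.Exports.
Local Open Scope classical_set_scope.
Local Open Scope ring_scope.

Section Defs.
Variable R : realType.
Variable n : nat.

Definition symmx (A : 'M[R]_n) : Prop := A^T = A.

Definition psdmx (A : 'M[R]_n) : Prop :=
  symmx A /\ forall x : 'cV[R]_n, 0 <= (x^T *m A *m x) 0 0.

Definition loewner_le (A B : 'M[R]_n) : Prop := psdmx (B - A).

Definition density (A : 'M[R]_n) : Prop := psdmx A /\ \tr A = 1.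

Definition expm (A : 'M[R]_n) : 'M[R]_n :=
  limn (series (fun k : nat => (k`!%:R)^-1 *: A ^+ k)).

(* matrix logarithm: the (unique, for positive definite Y) symmetric L
   with exp L = Y *)
Definition lnm (Y : 'M[R]_n) : 'M[R]_n :=
  xget 0 [set L | symmx L /\ expm L = Y].

End Defs.

(* Main.v *)
(* Round 1 costs at most 1, which the bound absorbs. This matters because Y_1
   may be singular, in which case lnm takes the junk value 0; all later Y_t
   are at least (alpha / n) I.

   For later rounds let L = ln Y_t, K = ln V_{t+1} = L - eta C_t - z I. Klein's
   inequality tr (V (L - K)) <= 0 bounds the regret of playing V_{t+1} by the
   increase tr (U K) - tr (U L), with no use of Golden-Thompson. It remains to
   bound x = tr ((Y_t - V_{t+1}) C_t). Write Y_t and V_{t+1} in eigenbases P, Q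
   with eigenvalues l_i, m_j, and set S = P^T Q, G = Q^T C_t P. Then
     x     = sum_ij (l_i - m_j) S_ij G_ji,
     eta x = tr ((Y_t - V_{t+1}) (L - K))
           = sum_ij (l_i - m_j) (ln l_i - ln m_j) S_ij^2,
   and Cauchy-Schwarz with (l - m)^2 <= (l + m) (l - m) (ln l - ln m) gives
   x <= 2 eta.

   The potential tr (U ln Y_t) lies in [- ln (n (T+1)), 0] and mixing lowers it
   by at most - ln (1 - alpha) <= 1 / T, so the sum over any interval telescopes. *)
Require Import Defs.
From HB Require Import structures.
From mathcomp Require Import all_boot all_order all_algebra.
From mathcomp Require Import all_classical all_reals all_analysis.
From mathcomp Require Import complex ring lra zify.
Set Implicit Arguments. Unset Strict Implicit. Unset Printing Implicit Defensive.
Import Order.TTheory GRing.Theory Num.Theory.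
Import numFieldNormedType.Exports.
Local Open Scope ring_scope.

(** * Spectral theorem for real symmetric matrices *)

Lemma sym_real_eigenvalue (R : rcfType) n (A : 'M[R]_n.+1) :
  A^T = A -> exists a, eigenvalue A a.
Proof.
move=> symA; pose f : {rmorphism R -> R[i]} := real_complex R.
(* Over [R[i]] the matrix is hermitian, hence unitarily diagonalisable with real eigenvalues. *)
have hA : map_mx f A \is hermsymmx.
  apply: realsym_hermsym.
    by apply/is_hermitianmxP; rewrite expr0 scale1r map_mx_id // map_trmx symA.
  by apply/mxOverP => i j; rewrite mxE; apply/complex_realP; exists (A i j).
have /hermitian_normalmx /orthomx_spectralP Adiag := hA.
have /mxOverP /(_ 0 0) /complex_realP [a def_a] := hermitian_spectral_diag_real hA.
(* The characteristic polynomial has its coefficients in [R], so a real root found over [R[i]] is a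
   root over [R]. *)
exists a; rewrite eigenvalue_root_char -(fmorph_root f) map_char_poly.
rewrite -eigenvalue_root_char.
set P := spectralmx _ in Adiag; have Pu : P \in unitmx by apply: spectral_unit.
apply/eigenvalueP; exists (row 0 P); last first.
  rewrite rowE mulmx_free_eq0 ?row_free_unit //.
  by apply/eqP => /matrixP /(_ 0 0) /eqP; rewrite !mxE eqxx oner_eq0.
rewrite Adiag !mulmxA -row_mul mulmxV // row1 -rowE row_diag_mx.
by rewrite def_a -scalemxAl -rowE.
Qed.

Lemma row_dot_eq0 (R : realDomainType) n (w : 'rV[R]_n) :
  (w *m w^T) 0 0 = 0 -> w = 0.
Proof.
rewrite mxE => /eqP; rewrite psumr_eq0 => [/allP w0|i _]; last first.
  by rewrite mxE -expr2 sqr_ge0.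
apply/rowP => i; have := w0 i (mem_index_enum i).
by rewrite !mxE /= mulf_eq0 orbb => /eqP.
Qed.

(* [P] is the Householder reflection exchanging the first basis vector and [u]. *)
Lemma reflection_to_unit_row (R : realFieldType) n (u : 'rV[R]_n.+1) :
  (u *m u^T) 0 0 = 1 ->
  exists P : 'M[R]_n.+1, [/\ P^T = P, P *m P = 1%:M & delta_mx 0 0 *m P = u].
Proof.
move=> u1; set e : 'rV[R]_n.+1 := delta_mx 0 0.
have [w def_w] : exists w, w = u - e by exists (u - e).
pose c := (w *m w^T) 0 0.
have ww : w *m w^T = c%:M by rewrite [LHS]mx11_scalar.
have ee : (e *m e^T) 0 0 = 1.
  by rewrite /e trmx_delta mul_delta_mx mxE !eqxx.
have uv : (u *m e^T) 0 0 = (e *m u^T) 0 0.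
  by rewrite -[u in LHS]trmxK -trmx_mul mxE.
(* As [e] and [u] are unit vectors, [c = 2 - 2 <e, u>], while [<e, w> = <e, u> - 1]. *)
have ew : e *m w^T = (- (c / 2))%:M.
  rewrite [LHS]mx11_scalar; congr _%:M; rewrite /c def_w linearB /=.
  rewrite !mulmxBl !mulmxBr.
  move: u1 ee uv; rewrite !mxE => -> -> ->.
  by field.
(* If [c = 0] then [u = e], where the reflection formula divides by zero and the identity serves
   instead. *)
have [c0|cn0] := eqVneq c 0.
  exists 1%:M; split; [exact: trmx1 | exact: mulmx1 | rewrite mulmx1].
  by apply/eqP; rewrite eq_sym -subr_eq0 -def_w; apply/eqP; exact: row_dot_eq0.
exists (1%:M - (2 / c) *: (w^T *m w)); split.
- by rewrite linearB /= linearZ /= trmx_mul trmxK trmx1.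
- rewrite mulmxBl !mulmxBr !mul1mx mulmx1 -scalemxAl -scalemxAr.
  rewrite mulmxA -(mulmxA w^T) ww mul_mx_scalar -scalemxAl !scalerA.
  have -> : 2 / c * (2 / c * c) = 2 / c + 2 / c :> R by field.
  by rewrite scalerDl opprB addrK subrK.
rewrite mulmxBr mulmx1 -scalemxAr mulmxA ew mul_scalar_mx scalerA.
have -> : 2 / c * - (c / 2) = -1 :> R by field.
by rewrite scaleN1r opprK def_w addrC subrK.
Qed.

(** Induction on the dimension: conjugating by a reflection that carries the first basis vector to a
    unit eigenvector splits off a 1 x 1 block, and symmetry clears the rest of its row and
    column. *)
Theorem sym_orthogonal_diag (R : rcfType) n (A : 'M[R]_n) : A^T = A ->
  exists (P : 'M[R]_n) (d : 'rV[R]_n), P^T *m P = 1%:M /\ A = P *m diag_mx d *m P^T.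
Proof.
elim: n A => [|n IHn] A symA.
  by exists 1%:M, 0; split; rewrite ?trmx1 ?mulmx1 // [A]flatmx0 [RHS]flatmx0.
have [a /eigenvalueP [v vA vn0]] := sym_real_eigenvalue symA.
pose c := (v *m v^T) 0 0.
have c0 : 0 < c.
  rewrite lt0r; apply/andP; split; first by apply: contra_neq vn0 => /row_dot_eq0.
  by rewrite /c mxE sumr_ge0 // => i _; rewrite mxE -expr2 sqr_ge0.
pose u := (Num.sqrt c)^-1 *: v.
have uA : u *m A = a *: u by rewrite -scalemxAl vA !scalerA mulrC.
have u1 : (u *m u^T) 0 0 = 1.
  rewrite linearZ /= -scalemxAl -scalemxAr scalerA mxE -/c -expr2 exprVn.
  by rewrite sqr_sqrtr ?ltW // mulVf ?gt_eqF.
have [P [symP PP eP]] := reflection_to_unit_row u1.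
have [B def_B] : exists B : 'M[R]_(1 + n), B = P *m A *m P by exists (P *m A *m P).
have symB : B^T = B by rewrite def_B !trmx_mul symA symP mulmxA.
have eB : delta_mx 0 0 *m B = a *: (delta_mx 0 0 : 'rV_(1 + n)).
  by rewrite def_B !mulmxA eP uA -scalemxAl -eP -mulmxA PP mulmx1.
have row0 j : B 0 j = a *+ (j == 0).
  by move/rowP/(_ j): eB; rewrite -rowE !mxE /= mulr_natr.
have Bblock : B = block_mx a%:M 0 0 (drsubmx B).
  rewrite -[LHS]submxK; congr block_mx.
  - by rewrite [LHS]mx11_scalar; congr _%:M; rewrite !mxE lshift0 row0.
  - by apply/matrixP => i j; rewrite !mxE ord1 lshift0 row0.
  - apply/matrixP => i j; rewrite -symB !mxE ord1 lshift0 row0.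
    by [].
have [|Q [d [QQ Bd]]] := IHn (drsubmx B).
  by rewrite trmx_drsub symB.
pose Q1 : 'M[R]_(1 + n) := block_mx 1%:M 0 0 Q.
have QQ1 : Q1^T *m Q1 = 1%:M.
  rewrite /Q1 tr_block_mx mulmx_block !trmx0 trmx1 mulmx1 QQ.
  by rewrite !(mul0mx, mulmx0, addr0, add0r) -scalar_mx_block.
have QB : B = Q1 *m diag_mx (row_mx a%:M d) *m Q1^T.
  rewrite {1}Bblock Bd diag_mx_row /Q1 tr_block_mx !mulmx_block.
  rewrite !trmx0 !(mul0mx, mulmx0, addr0, add0r) trmx1 mulmx1 mul1mx.
  by congr block_mx; apply/matrixP => i j; rewrite !ord1 !mxE.
exists (P *m Q1), (row_mx a%:M d); split.
  by rewrite trmx_mul symP -mulmxA (mulmxA P) PP mul1mx.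
transitivity (P *m B *m P).
  by rewrite def_B !mulmxA PP mul1mx -mulmxA PP mulmx1.
by rewrite trmx_mul symP QB !mulmxA.
Qed.

(** * Matrix exponential and logarithm in an orthonormal eigenbasis *)

Definition rotdiag (R : realType) n (P : 'M[R]_n) (d : 'rV[R]_n) : 'M[R]_n :=
  P *m diag_mx d *m P^T.

Section Rotdiag.
Variables (R : realType) (n : nat).
Implicit Types (P Q A : 'M[R]_n) (d e : 'rV[R]_n).

Lemma rotdiag_sym P d : (rotdiag P d)^T = rotdiag P d.
Proof. by rewrite !trmx_mul trmxK tr_diag_mx mulmxA. Qed.

Lemma rotdiagE P d : rotdiag P d = \sum_i d 0 i *: (col i P *m (col i P)^T).
Proof.
apply/matrixP => a b; rewrite summxE !mxE; apply: eq_bigr => i _.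
by rewrite mul_mx_diag !mxE big_ord1 !mxE mulrAC mulrC.
Qed.

Lemma rotdiag_exp P d k : P^T *m P = 1%:M ->
  rotdiag P d ^+ k = rotdiag P (map_mx (fun x => x ^+ k) d).
Proof.
move=> PP; elim: k => [|k IHk].
  rewrite expr0 /rotdiag (_ : diag_mx _ = 1%:M) ?mulmx1 ?(mulmx1C PP) //.
  by apply/matrixP => i j; rewrite !mxE.
rewrite exprS IHk -[LHS]/(_ *m _) /rotdiag !mulmxA -[X in X *m _ *m _]mulmxA PP mulmx1.
rewrite -(mulmxA P); congr (_ *m _ *m _); rewrite mulmx_diag; congr diag_mx.
by apply/rowP => i; rewrite !mxE exprS.
Qed.

Lemma expm_rotdiag P d : P^T *m P = 1%:M ->
  expm (rotdiag P d) = rotdiag P (map_mx expR d).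
Proof.
move=> PP.
(* Each partial sum is a finite combination of fixed rank-one matrices with scalar exponential sums
   as coefficients, so convergence reduces to the scalar case. *)
have seriesE : series (fun k => k`!%:R^-1 *: rotdiag P d ^+ k) =
    (fun N => \sum_i series (exp_coeff (d 0 i)) N *: (col i P *m (col i P)^T)).
  apply/funext => N; rewrite /series /=.
  under [RHS]eq_bigr do rewrite scaler_suml.
  rewrite exchange_big; apply: eq_bigr => k _.
  rewrite rotdiag_exp // rotdiagE scaler_sumr; apply: eq_bigr => i _.
  by rewrite scalerA mxE exp_coeffE.
rewrite /expm seriesE rotdiagE; apply/cvg_lim; first exact: norm_hausdorff.
apply: cvg_big => [|i _]; first exact: add_continuous.
by rewrite mxE; apply: cvgZr_tmp; exact: is_cvg_series_exp_coeff.
Qed.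

(** With [S = P^T Q], the hypothesis says that [S i j] vanishes unless [f (d 0 i) = f (e 0 j)].
    Injectivity removes [f], so [S] intertwines the two diagonals. For [f = expR] this is uniqueness
    of the symmetric logarithm. *)
Lemma rotdiag_map_inj (f : R -> R) P d Q e : injective f ->
  P^T *m P = 1%:M -> Q^T *m Q = 1%:M ->
  rotdiag P (map_mx f d) = rotdiag Q (map_mx f e) -> rotdiag P d = rotdiag Q e.
Proof.
move=> f_inj PP QQ eqf; pose S := P^T *m Q.
have intertwine d1 d2 : diag_mx d1 *m S = S *m diag_mx d2 ->
    rotdiag P d1 = rotdiag Q d2.
  rewrite /rotdiag /S => eqS; rewrite -[P^T in LHS]mulmx1 -(mulmx1C QQ).
  by rewrite -!mulmxA (mulmxA P^T) (mulmxA (diag_mx d1)) eqS !mulmxA (mulmx1C PP) mul1mx.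
have entrywise i j : S i j * (f (d 0 i) - f (e 0 j)) = 0.
  have eqS : diag_mx (map_mx f d) *m S = S *m diag_mx (map_mx f e).
    have <- : P^T *m rotdiag P (map_mx f d) *m Q = diag_mx (map_mx f d) *m S.
      by rewrite /rotdiag /S !mulmxA PP mul1mx.
    by rewrite eqf /rotdiag -!mulmxA QQ mulmx1 mulmxA.
  move: eqS; rewrite mul_diag_mx mul_mx_diag => /matrixP /(_ i j).
  by rewrite mxE [RHS]mxE !(mxE map_mx_key) mulrBr mulrC => ->; rewrite subrr.
apply: intertwine; rewrite mul_diag_mx mul_mx_diag; apply/matrixP => i j.
rewrite mxE [RHS]mxE mulrC; have /eqP := entrywise i j.
by rewrite mulf_eq0 subr_eq0 => /orP[/eqP->|/eqP/f_inj->]; rewrite ?mul0r.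
Qed.

(** This covers the default value 0 too, so the exponent of the update is symmetric even when [Y 1]
    is singular. *)
Lemma lnm_sym A : (lnm A)^T = lnm A.
Proof.
by rewrite /lnm; case: xgetP => [L _ []|_] //; rewrite trmx0.
Qed.

Lemma lnm_rotdiag P d : P^T *m P = 1%:M -> (forall i, 0 < d 0 i) ->
  lnm (rotdiag P d) = rotdiag P (map_mx (@ln R) d).
Proof.
move=> PP d_gt0; have lnmK : expm (rotdiag P (map_mx (@ln R) d)) = rotdiag P d.
  rewrite expm_rotdiag // -map_mx_comp; congr rotdiag.
  by apply/rowP => i; rewrite mxE /= lnK // posrE.
have [symL] : [set L | symmx L /\ expm L = rotdiag P d]%classic (lnm (rotdiag P d)).
  apply: xgetPex; exists (rotdiag P (map_mx (@ln R) d)).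
  by split => //; exact: rotdiag_sym.
have [Q [e [QQ ->]]] := sym_orthogonal_diag symL.
rewrite -lnmK -!/(rotdiag _ _) !expm_rotdiag //.
by apply: rotdiag_map_inj => //; exact: expR_inj.
Qed.

Lemma tr_rotdiag P d : P^T *m P = 1%:M -> \tr (rotdiag P d) = \sum_i d 0 i.
Proof. by move=> PP; rewrite mxtrace_mulC mulmxA PP mul1mx mxtrace_diag. Qed.

Lemma tr_rotdiag_mul P d A :
  \tr (rotdiag P d *m A) = \sum_i d 0 i * (P^T *m A *m P) i i.
Proof.
rewrite /rotdiag -!mulmxA mxtrace_mulC -mulmxA mul_diag_mx /mxtrace.
by apply: eq_bigr => i _; rewrite mxE !mulmxA.
Qed.

End Rotdiag.

(** * Scalar inequalities for the logarithm *)

Section ScalarLog.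
Variable R : realType.
Implicit Types x y : R.

Lemma ln_sub_le x y : 0 < x -> 0 < y -> ln x - ln y <= (x - y) / y.
Proof.
move=> x0 y0; rewrite -ln_div ?posrE //.
have -> : x / y = 1 + (x - y) / y by field; rewrite gt_eqF.
by apply: le_ln1Dx; rewrite mulrBl divff ?gt_eqF // ltrBrDl subrr divr_gt0.
Qed.

Lemma sqr_sub_le_ln x y : 0 < x -> 0 < y ->
  (x - y) ^+ 2 <= (x + y) * ((x - y) * (ln x - ln y)).
Proof.
wlog le_yx : x y / y <= x.
  move=> H x0 y0; have [|/ltW] := leP y x; first by move=> ?; exact: H.
  move=> /H /(_ y0 x0); rewrite -sqrrN opprB (addrC y); congr (_ <= _ * _).
  by rewrite -mulrNN !opprB.
(* The tangent bound gives [x - y <= x * (ln x - ln y)]. Multiplying by [x - y] and adding the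
   nonnegative term with factor [y] yields the symmetric weight [x + y]. *)
move=> x0 y0; have := ln_sub_le y0 x0.
rewrite ler_pdivlMr // => lnxy.
have lnd : 0 <= ln x - ln y by rewrite subr_ge0 ler_ln ?posrE.
have d0 : 0 <= x - y by rewrite subr_ge0.
have := ler_wpM2l d0 lnxy; have := mulr_ge0 (mulr_ge0 (ltW y0) d0) lnd.
by lra.
Qed.

End ScalarLog.

(** * Traces expanded over a pair of orthonormal bases *)

Section TracesInTwoBases.
Variables (R : realType) (n : nat) (P Q : 'M[R]_n).
Hypotheses (PP : P^T *m P = 1%:M) (QQ : Q^T *m Q = 1%:M).
Implicit Types (a b d e : 'rV[R]_n) (A C : 'M[R]_n).

Lemma rotdiagB d e : rotdiag P d - rotdiag P e = rotdiag P (d - e).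
Proof. by rewrite /rotdiag linearB mulmxBr mulmxBl. Qed.

Lemma rotdiagM d e :
  rotdiag P d *m rotdiag P e = rotdiag P (\row_i (d 0 i * e 0 i)).
Proof.
rewrite /rotdiag !mulmxA -[X in X *m _ *m _]mulmxA PP mulmx1.
by rewrite -(mulmxA P) mulmx_diag.
Qed.

Lemma rotdiag_const (x : R) : rotdiag P (const_mx x) = x%:M.
Proof.
by rewrite /rotdiag diag_const_mx mul_mx_scalar -scalemxAl (mulmx1C PP) scalemx1.
Qed.

Lemma rotdiag_psd d : (forall i, 0 <= d 0 i) -> psdmx (rotdiag P d).
Proof.
move=> d0; split=> [|x]; first exact: rotdiag_sym.
rewrite rotdiagE mulmx_sumr mulmx_suml summxE sumr_ge0 // => i _.
rewrite -scalemxAr -scalemxAl mxE mulr_ge0 // mulmxA -(mulmxA (x^T *m _)).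
have -> : (x^T *m col i P) = ((col i P)^T *m x)^T by rewrite trmx_mul trmxK.
by rewrite mxE big_ord1 mxE -expr2 sqr_ge0.
Qed.

Lemma psd_diag_ge0 A i : psdmx A -> 0 <= (P^T *m A *m P) i i.
Proof.
move=> [_ /(_ (col i P))]; congr (_ <= _); rewrite tr_col -row_mul [LHS]mxE [RHS]mxE.
by apply: eq_bigr => k _; rewrite [row _ _ _ _]mxE [col _ _ _ _]mxE.
Qed.

Lemma rotdiag_diag d i : (P^T *m rotdiag P d *m P) i i = d 0 i.
Proof.
by rewrite /rotdiag !mulmxA PP mul1mx -mulmxA PP mulmx1 mxE eqxx.
Qed.

(** Together with the column version: the squared entries of the orthogonal matrix [P^T Q] form a
    doubly stochastic matrix. *)
Lemma overlap_row_sum i : \sum_j (P^T *m Q) i j ^+ 2 = 1.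
Proof.
have /matrixP /(_ i i) : (P^T *m Q) *m (P^T *m Q)^T = 1%:M.
  by rewrite trmx_mul trmxK mulmxA -(mulmxA P^T) (mulmx1C QQ) mulmx1.
rewrite mxE [RHS]mxE eqxx mulr1n => <-; apply: eq_bigr => j _.
by rewrite expr2 [_^T _ _]mxE.
Qed.

Lemma overlap_col_sum j : \sum_i (P^T *m Q) i j ^+ 2 = 1.
Proof.
have /matrixP /(_ j j) : (P^T *m Q)^T *m (P^T *m Q) = 1%:M.
  by rewrite trmx_mul trmxK mulmxA -(mulmxA Q^T) (mulmx1C PP) mulmx1.
rewrite mxE [RHS]mxE eqxx mulr1n => <-; apply: eq_bigr => i _.
by rewrite expr2 [_^T _ _]mxE.
Qed.

Let S i j := (P^T *m Q) i j.

(** The redundant sum over [j] puts a one-basis trace in the same double-sum form as the cross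
    traces, so that they can be compared term by term. *)
Lemma tr_rotdiag_same_row a b :
  \tr (rotdiag P a *m rotdiag P b) = \sum_i \sum_j a 0 i * b 0 i * S i j ^+ 2.
Proof.
rewrite rotdiagM tr_rotdiag //; apply: eq_bigr => i _.
by rewrite -mulr_sumr overlap_row_sum mulr1 mxE.
Qed.

Lemma tr_rotdiag_cross a b :
  \tr (rotdiag P a *m rotdiag Q b) = \sum_i \sum_j a 0 i * b 0 j * S i j ^+ 2.
Proof.
rewrite tr_rotdiag_mul; apply: eq_bigr => i _.
have -> : P^T *m rotdiag Q b *m P = (P^T *m Q) *m diag_mx b *m (P^T *m Q)^T.
  by rewrite trmx_mul trmxK /rotdiag !mulmxA.
rewrite [X in _ * X]mxE mulr_sumr; apply: eq_bigr => j _.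
by rewrite mul_mx_diag mxE [_^T _ _]mxE expr2 /S; ring.
Qed.

Lemma tr_rotdiag_left a C :
  \tr (rotdiag P a *m C) = \sum_i \sum_j a 0 i * (S i j * (Q^T *m C *m P) j i).
Proof.
rewrite tr_rotdiag_mul; apply: eq_bigr => i _; rewrite -mulr_sumr; congr (_ * _).
have -> : P^T *m C *m P = (P^T *m Q) *m (Q^T *m C *m P).
  by rewrite !mulmxA -(mulmxA P^T Q) (mulmx1C QQ) mulmx1.
by rewrite mxE.
Qed.

End TracesInTwoBases.

Lemma tr_rotdiag_same_col (R : realType) n (P Q : 'M[R]_n) a b :
  P^T *m P = 1%:M -> Q^T *m Q = 1%:M ->
  \tr (rotdiag Q a *m rotdiag Q b) =
  \sum_i \sum_j a 0 j * b 0 j * (P^T *m Q) i j ^+ 2.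
Proof.
move=> PP QQ; rewrite exchange_big rotdiagM // tr_rotdiag //; apply: eq_bigr => j _.
by rewrite -mulr_sumr overlap_col_sum // mulr1 mxE.
Qed.

Lemma tr_rotdiag_right (R : realType) n (P Q : 'M[R]_n) b C :
  P^T *m P = 1%:M ->
  \tr (rotdiag Q b *m C) =
  \sum_i \sum_j b 0 j * ((P^T *m Q) i j * (Q^T *m C *m P) j i).
Proof.
move=> PP; rewrite exchange_big tr_rotdiag_mul; apply: eq_bigr => j _.
rewrite -mulr_sumr; congr (_ * _).
have -> : Q^T *m C *m Q = (Q^T *m C *m P) *m (P^T *m Q).
  by rewrite !mulmxA -(mulmxA (Q^T *m C) P) (mulmx1C PP) mulmx1.
by rewrite mxE; apply: eq_bigr => i _; rewrite mulrC.
Qed.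

(** * Positivity, contractions and Klein's inequality *)

Section DensityUpdate.
Variables (R : realType) (n : nat).
Implicit Types (P Q C U : 'M[R]_n) (l m : 'rV[R]_n).

Lemma psd_tr_mul_ge0 (A B : 'M[R]_n) : psdmx A -> psdmx B -> 0 <= \tr (A *m B).
Proof.
move=> psdA psdB; have [P [d [PP defA]]] := sym_orthogonal_diag psdA.1.
rewrite -/(rotdiag P d) in defA.
rewrite defA tr_rotdiag_mul sumr_ge0 // => i _.
by rewrite mulr_ge0 ?psd_diag_ge0 // -(rotdiag_diag PP) -defA psd_diag_ge0.
Qed.

(** The eigenvalues of [C] lie in [0, 1], hence so do their squares, and [1 - C^2] is positive
    semidefinite. *)
Lemma contraction_sqr_diag_le1 P C i : P^T *m P = 1%:M ->
  psdmx C -> loewner_le C 1%:M -> (P^T *m (C *m C) *m P) i i <= 1.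
Proof.
move=> PP psdC C1; have [W [c [WW defC]]] := sym_orthogonal_diag psdC.1.
rewrite -/(rotdiag W c) in defC.
have c0 k : 0 <= c 0 k by rewrite -(rotdiag_diag WW) -defC psd_diag_ge0.
have c1 k : c 0 k <= 1.
  have := psd_diag_ge0 W k C1; rewrite mulmxBr mulmxBl mulmx1 WW defC mxE.
  by rewrite [in X in _ + X]mxE rotdiag_diag // mxE eqxx subr_ge0.
have : psdmx (1%:M - C *m C).
  rewrite defC rotdiagM // -(rotdiag_const WW) rotdiagB; apply: rotdiag_psd => k.
  by rewrite !mxE subr_ge0 mulr_ile1.
move=> /(psd_diag_ge0 P i); rewrite mulmxBr mulmxBl mulmx1 PP mxE.
by rewrite [in X in _ + X]mxE mxE eqxx subr_ge0.
Qed.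

(** The tangent bound [m_j (ln l_i - ln m_j) <= l_i - m_j] is averaged with the doubly stochastic
    weights; the right side then sums to the difference of the traces, which is 0. *)
Lemma klein_inequality P l Q m : P^T *m P = 1%:M -> Q^T *m Q = 1%:M ->
  (forall i, 0 < l 0 i) -> (forall i, 0 < m 0 i) -> \sum_i l 0 i = \sum_i m 0 i ->
  \tr (rotdiag Q m *m (rotdiag P (map_mx (@ln R) l) - rotdiag Q (map_mx (@ln R) m)))
    <= 0.
Proof.
move=> PP QQ l0 m0 lm; rewrite mulmxBr linearB /=.
rewrite mxtrace_mulC tr_rotdiag_cross // (tr_rotdiag_same_col _ _ PP QQ).
rewrite -sumrB.
apply: (@le_trans _ _ (\sum_i \sum_j (l 0 i - m 0 j) * (P^T *m Q) i j ^+ 2)).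
  apply: ler_sum => i _; rewrite -sumrB; apply: ler_sum => j _.
  rewrite !mxE -mulrBl ler_wpM2r ?sqr_ge0 // mulrC -mulrBr mulrC.
  by rewrite -ler_pdivlMr // ln_sub_le.
under eq_bigr do (under eq_bigr do rewrite mulrBl; rewrite sumrB).
rewrite sumrB [X in _ - X]exchange_big /=.
under eq_bigr do rewrite -mulr_sumr overlap_row_sum // mulr1.
under [X in _ - X]eq_bigr do rewrite -mulr_sumr overlap_col_sum // mulr1.
by rewrite lm subrr.
Qed.

End DensityUpdate.

(** * Stability of one exponentiated step *)

Section Step.
Variables (R : realType) (n : nat).
Implicit Types (P Q C U : 'M[R]_n) (l m : 'rV[R]_n).

Lemma log_stability P l Q m C (eta : R) : P^T *m P = 1%:M -> Q^T *m Q = 1%:M ->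
  (forall i, 0 < l 0 i) -> (forall i, 0 < m 0 i) ->
  \sum_i l 0 i = 1 -> \sum_i m 0 i = 1 -> psdmx C -> loewner_le C 1%:M ->
  0 < eta ->
  \tr ((rotdiag P l - rotdiag Q m) *m
       (rotdiag P (map_mx (@ln R) l) - rotdiag Q (map_mx (@ln R) m)))
    = eta * \tr ((rotdiag P l - rotdiag Q m) *m C) ->
  \tr ((rotdiag P l - rotdiag Q m) *m C) <= 2 * eta.
Proof.
move=> PP QQ l0 m0 l1 m1 psdC C1 eta0.
pose S i j := (P^T *m Q) i j; pose G j i := (Q^T *m C *m P) j i.
pose gap i j := (l 0 i - m 0 j) * (ln (l 0 i) - ln (m 0 j)).
have -> : \tr ((rotdiag P l - rotdiag Q m) *m
    (rotdiag P (map_mx (@ln R) l) - rotdiag Q (map_mx (@ln R) m))) =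
    \sum_i \sum_j gap i j * S i j ^+ 2.
  rewrite mulmxBl !mulmxBr !linearB /= (tr_rotdiag_same_row PP QQ) tr_rotdiag_cross.
  rewrite (tr_rotdiag_same_col _ _ PP QQ) [\tr (rotdiag Q _ *m rotdiag P _)]mxtrace_mulC.
  rewrite tr_rotdiag_cross -!sumrN -!big_split /=; apply: eq_bigr => i _.
  rewrite -!sumrN -!big_split /=; apply: eq_bigr => j _.
  by rewrite ![map_mx _ _ _ _]mxE /gap /S; ring.
set x := \tr _; have xE : x = \sum_i \sum_j (l 0 i - m 0 j) * (S i j * G j i).
  rewrite /x mulmxBl linearB /= (tr_rotdiag_left _ QQ) (tr_rotdiag_right _ _ _ PP).
  rewrite -sumrB; apply: eq_bigr => i _; rewrite -sumrB; apply: eq_bigr => j _.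
  by rewrite mulrBl.
move=> gapE.
(* For fixed [i], summing [G j i ^+ 2] over [j] gives a diagonal entry of [P^T C^2 P], which is at
   most 1. *)
have GGrow : \sum_i \sum_j l 0 i * G j i ^+ 2 <= 1.
  rewrite -[leRHS]l1; apply: ler_sum => i _; rewrite -mulr_sumr.
  apply: ler_piMr; first exact/ltW.
  have := contraction_sqr_diag_le1 i PP psdC C1.
  have -> : P^T *m (C *m C) *m P = (Q^T *m C *m P)^T *m (Q^T *m C *m P).
    rewrite !trmx_mul trmxK psdC.1 !mulmxA -(mulmxA (P^T *m C) Q) (mulmx1C QQ).
    by rewrite mulmx1.
  rewrite mxE; congr (_ <= _); apply: eq_bigr => j _.
  by rewrite [X in X * _]mxE -expr2.
have GGcol : \sum_i \sum_j m 0 j * G j i ^+ 2 <= 1.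
  rewrite exchange_big -[leRHS]m1; apply: ler_sum => j _.
  rewrite -mulr_sumr.
  apply: ler_piMr; first exact/ltW.
  have := contraction_sqr_diag_le1 j QQ psdC C1.
  have -> : Q^T *m (C *m C) *m Q = (Q^T *m C *m P) *m (Q^T *m C *m P)^T.
    rewrite !trmx_mul trmxK psdC.1 !mulmxA -(mulmxA (Q^T *m C) P) (mulmx1C PP).
    by rewrite mulmx1.
  rewrite mxE; congr (_ <= _); apply: eq_bigr => i _.
  by rewrite [X in _ * X]mxE -expr2.
(* Cauchy-Schwarz is used in its arithmetic-geometric form: the right side equals [x / 2 + eta], and
   half of [x] is absorbed on the left. *)
suff : x <= (2 * eta)^-1 * (eta * x) + eta / 2 * (1 + 1).
  have -> : (2 * eta)^-1 * (eta * x) = x / 2 by field; rewrite gt_eqF.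
  by lra.
have GG : eta / 2 * (\sum_i \sum_j l 0 i * G j i ^+ 2 +
    \sum_i \sum_j m 0 j * G j i ^+ 2) <= eta / 2 * (1 + 1).
  by rewrite ler_pM2l ?divr_gt0 // lerD.
apply: le_trans (lerD (lexx _) GG); rewrite -gapE {1}xE.
rewrite -big_split !mulr_sumr -big_split; apply: ler_sum => i _ /=.
rewrite -big_split !mulr_sumr -big_split; apply: ler_sum => j _ /=.
have gap_ge := sqr_sub_le_ln (l0 i) (m0 j).
have p0 : 0 < l 0 i + m 0 j by rewrite addr_gt0.
(* Expanding this square and dividing by [2 * eta * (l_i + m_j)] bounds the [(i, j)] term of [x];
   [gapS] then trades the squared difference for the logarithmic gap. *)
have := sqr_ge0 ((l 0 i - m 0 j) * S i j - eta * (l 0 i + m 0 j) * G j i).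
have gapS : (l 0 i - m 0 j) ^+ 2 * S i j ^+ 2 <= (l 0 i + m 0 j) * gap i j * S i j ^+ 2.
  by rewrite ler_wpM2r ?sqr_ge0.
have ep0 : 0 < 2 * eta * (l 0 i + m 0 j) by rewrite !mulr_gt0.
move=> sq0; rewrite -(ler_pM2l ep0).
have -> : 2 * eta * (l 0 i + m 0 j) * ((2 * eta)^-1 * (gap i j * S i j ^+ 2) +
      eta / 2 * (l 0 i * G j i ^+ 2 + m 0 j * G j i ^+ 2)) =
    (l 0 i + m 0 j) * gap i j * S i j ^+ 2 + (eta * (l 0 i + m 0 j) * G j i) ^+ 2.
  by field; rewrite gt_eqF.
by lra.
Qed.

End Step.

(** * Gibbs states and the regret of one round *)

Section Rounds.
Variables (R : realType) (n : nat).
Implicit Types (P Q C U H : 'M[R]_n) (d e l m : 'rV[R]_n).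

Lemma density_tr_rotdiag_ge Q d U (c : R) : Q^T *m Q = 1%:M ->
  density U -> (forall i, c <= d 0 i) -> c <= \tr (U *m rotdiag Q d).
Proof.
move=> QQ [psdU trU] cd.
have : psdmx (rotdiag Q d - c%:M).
  rewrite -(rotdiag_const QQ) rotdiagB; apply: rotdiag_psd => i.
  by rewrite !mxE subr_ge0.
move=> /(psd_tr_mul_ge0 psdU); rewrite mulmxBr linearB /= mul_mx_scalar linearZ /=.
by rewrite trU mulr1 subr_ge0.
Qed.

Lemma density_tr_rotdiag_le0 Q d U : Q^T *m Q = 1%:M ->
  density U -> (forall i, d 0 i <= 0) -> \tr (U *m rotdiag Q d) <= 0.
Proof.
move=> QQ dU d0; have := @density_tr_rotdiag_ge Q (0 - d) U 0 QQ dU.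
rewrite -rotdiagB mulmxBr linearB /= (_ : rotdiag Q 0 = 0); last first.
  by rewrite /rotdiag linear0 mulmx0 mul0mx.
rewrite mulmx0 linear0 !sub0r oppr_ge0; apply=> i.
by rewrite mxE oppr_ge0.
Qed.

(** Dividing the exponential by its trace keeps the eigenvectors and only shifts the logarithm by a
    scalar matrix. *)
Lemma gibbs_state_diag H : (0 < n)%N -> H^T = H ->
  exists Q m, [/\ Q^T *m Q = 1%:M, forall i, 0 < m 0 i, \sum_i m 0 i = 1,
    (\tr (expm H))^-1 *: expm H = rotdiag Q m &
    rotdiag Q (map_mx (@ln R) m) = H - (ln (\tr (expm H)))%:M].
Proof.
move=> n0 /sym_orthogonal_diag [Q [h [QQ defH]]]; rewrite -/(rotdiag Q h) in defH.
have expH : expm H = rotdiag Q (map_mx expR h) by rewrite defH expm_rotdiag.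
set Z := \tr (expm H).
have ZE : Z = \sum_i expR (h 0 i).
  by rewrite /Z expH tr_rotdiag //; apply: eq_bigr => i _; rewrite mxE.
have Z0 : 0 < Z.
  by rewrite ZE (bigD1 (Ordinal n0)) //= ltr_pwDl ?expR_gt0 // sumr_ge0.
exists Q, (Z^-1 *: map_mx expR h); split => //.
- by move=> i; rewrite !mxE mulr_gt0 ?invr_gt0 ?expR_gt0.
- under eq_bigr do rewrite !mxE.
  by rewrite -mulr_sumr -ZE mulVf ?gt_eqF.
- by rewrite expH /rotdiag linearZ /= -scalemxAr -scalemxAl.
rewrite [in RHS]defH -(rotdiag_const QQ) rotdiagB; congr rotdiag.
apply/rowP => i; rewrite !mxE lnM ?posrE ?invr_gt0 ?expR_gt0 //.
by rewrite lnV ?posrE // expRK addrC.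
Qed.

(** Writing [z] for the log of the normaliser, Klein gives [eta * tr (V C) <= - z], and [defK]
    expresses [- z] through the increase of the potential of [U] plus [eta * tr (U C)]. Passing from
    [V] to the played state costs [eta] times the stability bound. *)
Lemma mirror_step_regret P l C U (eta : R) (H := lnm (rotdiag P l) - eta *: C) Q m :
  P^T *m P = 1%:M -> (forall i, 0 < l 0 i) -> \sum_i l 0 i = 1 ->
  Q^T *m Q = 1%:M -> (forall i, 0 < m 0 i) -> \sum_i m 0 i = 1 ->
  rotdiag Q (map_mx (@ln R) m) = H - (ln (\tr (expm H)))%:M ->
  psdmx C -> loewner_le C 1%:M -> 0 < eta -> density U ->
  eta * (\tr (rotdiag P l *m C) - \tr (U *m C)) <=
  \tr (U *m rotdiag Q (map_mx (@ln R) m)) - \tr (U *m lnm (rotdiag P l)) +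
  2 * eta ^+ 2.
Proof.
rewrite /H => PP l0 l1 QQ m0 m1; rewrite lnm_rotdiag //.
set z := ln _; set L := rotdiag P _; set K := rotdiag Q _ => defK.
move=> psdC C1 eta0 [psdU trU].
have LK : L - K = eta *: C + z%:M by rewrite defK !opprB addrCA (addrC L) subrK addrC.
have klein : eta * \tr (rotdiag Q m *m C) + z <= 0.
  have := @klein_inequality R n P l Q m PP QQ l0 m0; rewrite l1 m1 => /(_ erefl).
  rewrite -/L -/K LK mulmxDr linearD /= -scalemxAr mul_mx_scalar !mxtraceZ.
  by rewrite tr_rotdiag // m1 mulr1.
have UK : \tr (U *m K) = \tr (U *m L) - eta * \tr (U *m C) - z.
  rewrite defK !mulmxBr !linearB /= -scalemxAr mul_mx_scalar !mxtraceZ.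
  by rewrite trU mulr1.
have := log_stability PP QQ l0 m0 l1 m1 psdC C1 eta0.
rewrite -/L -/K LK mulmxDr linearD /= -scalemxAr mul_mx_scalar !mxtraceZ.
rewrite [\tr (_ - _)]linearB /= !tr_rotdiag // l1 m1 subrr mulr0 addr0 => /(_ erefl).
rewrite mulmxBl linearB /= => stab.
have := ler_wpM2l (ltW eta0) stab.
by rewrite UK; lra.
Qed.

End Rounds.

Lemma density_tr_mul_itv (R : realType) n (U C : 'M[R]_n) :
  density U -> psdmx C -> loewner_le C 1%:M -> 0 <= \tr (U *m C) <= 1.
Proof.
move=> [psdU trU] psdC /(psd_tr_mul_ge0 psdU).
by rewrite mulmxBr mulmx1 linearB /= trU subr_ge0 => ->; rewrite psd_tr_mul_ge0.
Qed.

(** * Mixing with the uniform state and summation over the rounds *)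

Section FixedShare.
Variables (R : realType) (n T : nat) (C Y : nat -> 'M[R]_n).
Let alpha : R := (T.+1%:R)^-1.
Let N : R := ln (n%:R * (1 + T%:R)).
Let eta : R := Num.sqrt N / Num.sqrt T%:R.
Hypotheses (n0 : (0 < n)%N) (T0 : (1 <= T)%N).
Hypothesis psdC : forall t, (1 <= t <= T)%N -> psdmx (C t).
Hypothesis C1 : forall t, (1 <= t <= T)%N -> loewner_le (C t) 1%:M.
Let H t := lnm (Y t) - eta *: C t.
Hypothesis recY : forall t, (1 <= t <= T)%N ->
  Y t.+1 = (alpha / n%:R) *: 1%:M +
           (1 - alpha) *: ((\tr (expm (H t)))^-1 *: expm (H t)).
Variable U : 'M[R]_n.
Hypothesis dU : density U.

Let alpha_gt0 : 0 < alpha. Proof. by rewrite invr_gt0. Qed.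

Let alpha_lt1 : alpha < 1.
Proof. by rewrite invf_lt1 // ltr1n ltnS. Qed.

Let N_ge : 1 / 2 <= N.
Proof.
have ln2 : 1 / 2 <= ln (2 : R).
  have := @ln_sub_le R 1 2 ltr01 (ltr0Sn _ 1); rewrite ln1.
  by have -> : (1 - 2) / 2 = - (1 / 2) :> R by [field|]; lra.
apply: le_trans ln2 _; rewrite ler_ln ?posrE //; last first.
  by rewrite mulr_gt0 ?ltr0n // ltr_wpDr.
by rewrite nat1r -natrM ler_nat; lia.
Qed.

Let T_gt0 : 0 < T%:R :> R. Proof. by rewrite ltr0n. Qed.

Let N_gt0 : 0 < N. Proof. by apply: lt_le_trans N_ge; lra. Qed.

Let eta_gt0 : 0 < eta. Proof. by rewrite divr_gt0 ?sqrtr_gt0. Qed.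

Let etaT : eta ^+ 2 * T%:R = N.
Proof. by rewrite expr_div_n !sqr_sqrtr ?ltW // divfK ?gt_eqF. Qed.

Let eta_sqrt : eta * Num.sqrt (T%:R * N) = N.
Proof.
rewrite sqrtrM ?ltW // mulrA divfK ?gt_eqF ?sqrtr_gt0 //.
by rewrite -expr2 sqr_sqrtr ?ltW.
Qed.

(** The smallest eigenvalue that mixing allows is [1 / (n (T + 1))], so [N] bounds the range of the
    potential. *)
Let ln_floor : ln (alpha / n%:R) = - N.
Proof.
rewrite -lnV ?posrE; last by rewrite mulr_gt0 ?ltr0n // ltr_wpDr.
by rewrite /alpha -nat1r invfM mulrC.
Qed.

Let ln_decay : - ln (1 - alpha) <= T%:R^-1.
Proof.
have a1 : 0 < 1 - alpha by rewrite subr_gt0.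
have := ln_sub_le ltr01 a1; rewrite ln1 sub0r => /le_trans; apply.
have T1 : 0 < 1 + T%:R :> R by rewrite ltr_wpDr.
rewrite le_eqVlt; apply/orP; left; apply/eqP.
by rewrite /alpha -nat1r; field; rewrite !gt_eqF.
Qed.

(** Mixing acts on the eigenvalues alone, so [Y t.+1] shares an eigenbasis with the unmixed Gibbs
    state and their logarithms compare entrywise. *)
Let mixed_state t : (1 <= t <= T)%N -> exists (Q : 'M[R]_n) (m : 'rV[R]_n),
  [/\ Q^T *m Q = 1%:M, forall i, 0 < m 0 i, \sum_i m 0 i = 1,
    rotdiag Q (map_mx (@ln R) m) = H t - (ln (\tr (expm (H t))))%:M &
    Y t.+1 = rotdiag Q (map_mx (fun x => alpha / n%:R + (1 - alpha) * x) m)].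
Proof.
move=> tT; have symH : (H t)^T = H t.
  by rewrite /H linearB linearZ /= lnm_sym (psdC tT).1.
have [Q [m [QQ m0 m1 VE lnV]]] := gibbs_state_diag n0 symH.
exists Q, m; split => //; rewrite recY // VE.
rewrite scalemx1 -(rotdiag_const QQ) /rotdiag scalemxAl scalemxAr -mulmxDl -mulmxDr.
congr (_ *m _ *m _); rewrite -linearZ -linearD; congr diag_mx.
by apply/rowP => i; rewrite !mxE.
Qed.

(** The range starts at 2 because only mixed states have the eigenvalue floor, and reaches [T.+1]
    because the telescoping sum ends at [phi s.+1]. *)
Let state t : (2 <= t <= T.+1)%N -> exists (P : 'M[R]_n) (l : 'rV[R]_n),
  [/\ P^T *m P = 1%:M, Y t = rotdiag P l, \sum_i l 0 i = 1 &
      forall i, alpha / n%:R <= l 0 i <= 1].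
Proof.
case: t => // t tT; have [|Q [m [QQ m0 m1 _ ->]]] := @mixed_state t; first lia.
have l1 : \sum_i (map_mx (fun x => alpha / n%:R + (1 - alpha) * x) m) 0 i = 1.
  under eq_bigr do rewrite mxE.
  rewrite big_split /= sumr_const card_ord -mulr_sumr m1 mulr1 -[_ / _ *+ _]mulr_natr.
  by rewrite divfK ?pnatr_eq0 -?lt0n // addrC subrK.
have l0 i : alpha / n%:R <= (map_mx (fun x => alpha / n%:R + (1 - alpha) * x) m) 0 i.
  by rewrite mxE lerDl mulr_ge0 ?ltW // subr_gt0.
exists Q, (map_mx (fun x => alpha / n%:R + (1 - alpha) * x) m); split => // i.
rewrite l0 /= -[leRHS]l1 (bigD1 i) //= lerDl sumr_ge0 // => j _.
by apply: le_trans (l0 j); rewrite divr_ge0 // ltW.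
Qed.

Let floor_gt0 : 0 < alpha / n%:R. Proof. by rewrite divr_gt0 ?ltr0n. Qed.

Let phi t := \tr (U *m lnm (Y t)).

Let phi_itv t : (2 <= t <= T.+1)%N -> - N <= phi t <= 0.
Proof.
move=> /state [P [l [PP Yt _ l_itv]]].
have l0 i : 0 < l 0 i by apply: lt_le_trans floor_gt0 _; case/andP: (l_itv i).
rewrite /phi Yt lnm_rotdiag //; apply/andP; split.
  apply: density_tr_rotdiag_ge => // i; rewrite mxE -ln_floor ler_ln ?posrE //.
  by case/andP: (l_itv i).
apply: density_tr_rotdiag_le0 => // i; rewrite mxE ln_le0 //.
by case/andP: (l_itv i).
Qed.

Let round_regret t : (2 <= t <= T)%N ->
  eta * (\tr (Y t *m C t) - \tr (U *m C t)) <=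
  phi t.+1 - phi t + (T%:R^-1 + 2 * eta ^+ 2).
Proof.
move=> tT; have tT1 : (1 <= t <= T)%N by lia.
have [|P [l [PP Yt l1 l_itv]]] := @state t; first lia.
have l0 i : 0 < l 0 i by apply: lt_le_trans floor_gt0 _; case/andP: (l_itv i).
have [Q [m [QQ m0 m1 lnV Yt1]]] := mixed_state tT1.
move: lnV; rewrite /H Yt => lnV.
have := mirror_step_regret PP l0 l1 QQ m0 m1 lnV (psdC tT1) (C1 tT1) eta_gt0 dU.
(* A mixed eigenvalue is at least [(1 - alpha)] times the old one, so no logarithm falls by more
   than [- ln (1 - alpha)]. *)
have phi1 : \tr (U *m rotdiag Q (map_mx (@ln R) m)) + ln (1 - alpha) <= phi t.+1.
  rewrite /phi Yt1 lnm_rotdiag //; last first.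
    by move=> i; rewrite mxE ltr_pwDl // mulr_ge0 ?ltW // subr_gt0.
  rewrite -lerBrDl -linearB /= -mulmxBr rotdiagB; apply: density_tr_rotdiag_ge => // i.
  rewrite !mxE lerBrDr -lnM ?posrE ?subr_gt0 //.
  rewrite ler_ln ?posrE ?lerDr ?ltW // ?mulr_gt0 ?subr_gt0 //.
  by rewrite addr_gt0 // mulr_gt0 ?subr_gt0.
have phi0 : phi t = \tr (U *m lnm (rotdiag P l)) by rewrite /phi Yt.
rewrite -phi0; have := ln_decay; lra.
Qed.

(** The bound [r <= s.+1] admits the empty interval, which arises when round 1 is split off from
    [r = s = 1]. *)
Lemma regret_from_round2 r s : (2 <= r)%N -> (r <= s.+1)%N -> (s <= T)%N ->
  \sum_(r <= t < s.+1) (\tr (Y t *m C t) - \tr (U *m C t)) <=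
  5 * Num.sqrt (T%:R * N).
Proof.
move=> r2 rs sT; rewrite -(ler_pM2l eta_gt0) mulrCA eta_sqrt mulr_sumr.
apply: (@le_trans _ _ (\sum_(r <= t < s.+1)
    (phi t.+1 - phi t + (T%:R^-1 + 2 * eta ^+ 2)))).
  by rewrite big_nat [leRHS]big_nat; apply: ler_sum => t rts; apply: round_regret; lia.
rewrite big_split /= telescope_sumr // sumr_const_nat -mulr_natr.
have /andP[phir _] := @phi_itv r ltac:(lia).
have /andP[_ phis] := @phi_itv s.+1 ltac:(lia).
have c0 : 0 <= T%:R^-1 + 2 * eta ^+ 2.
  by rewrite addr_ge0 ?invr_ge0 ?ler0n // mulr_ge0 ?sqr_ge0.
have : (T%:R^-1 + 2 * eta ^+ 2) * (s.+1 - r)%:R <= (T%:R^-1 + 2 * eta ^+ 2) * T%:R.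
  by rewrite ler_wpM2l // ler_nat; lia.
(* The potential contributes at most [N] and the drift at most [1 + 2 * N]; since [1 <= 2 * N], the
   total is at most [5 * N]. *)
by rewrite [leRHS]mulrDl -mulrA etaT mulVf ?gt_eqF //; have := N_ge; lra.
Qed.

Lemma regret_bound r s : density (Y 1%N) ->
  (1 <= r)%N -> (r <= s)%N -> (s <= T)%N ->
  \sum_(r <= t < s.+1) (\tr (Y t *m C t) - \tr (U *m C t)) <=
  7 * Num.sqrt (T%:R * N).
Proof.
move=> dY1 r1 rs sT; have root_ge : 1 / 2 <= Num.sqrt (T%:R * N).
  rewrite -(@ger0_norm R (1 / 2)) ?divr_ge0 // -sqrtr_sqr ler_wsqrtr //.
  have : 1 * N <= T%:R * N by rewrite (ler_wpM2r (ltW N_gt0)) ?ler1n.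
  by have := N_ge; lra.
(* Round 1 is bounded directly by 1, which is at most twice the square root; this raises the
   constant from 5 to 7. *)
have [r_eq1|r2] : r = 1%N \/ (2 <= r)%N by lia.
  rewrite r_eq1 big_ltn; last lia.
  have tail := @regret_from_round2 2 s isT ltac:(lia) sT.
  have oneT : (1 <= 1 <= T)%N by rewrite T0.
  have /andP[_ Y1] := density_tr_mul_itv dY1 (psdC oneT) (C1 oneT).
  have /andP[U0 _] := density_tr_mul_itv dU (psdC oneT) (C1 oneT).
  have round1 : (\tr (Y 1%N *m C 1%N) - \tr (U *m C 1%N)) <= 1 by lra.
  by apply: le_trans (lerD round1 tail) _; lra.
have := @regret_from_round2 r s r2 ltac:(lia) sT; lra.
Qed.

End FixedShare.

Theorem theorem4p5 (R : realType) :
  exists K : R, forall (n T : nat) (C Y : nat -> 'M[R]_n),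
    (1 <= T)%N ->
    (forall t, (1 <= t <= T)%N -> symmx (C t) /\ loewner_le 0 (C t) /\ loewner_le (C t) 1%:M) ->
    density (Y 1%N) ->
    (let alpha : R := (T.+1%:R)^-1 in
     let eta : R := Num.sqrt (ln (n%:R * (1 + T%:R))) / Num.sqrt T%:R in
     forall t, (1 <= t <= T)%N ->
       let M := expm (lnm (Y t) - eta *: C t) in
       let V := (\tr M)^-1 *: M in
       Y t.+1 = (alpha / n%:R) *: 1%:M + (1 - alpha) *: V) ->
    forall r s : nat, (1 <= r)%N -> (r <= s)%N -> (s <= T)%N ->
    forall U : 'M[R]_n, density U ->
      \sum_(r <= t < s.+1) \tr (Y t *m C t) - \sum_(r <= t < s.+1) \tr (U *m C t)
        <= K * Num.sqrt (T%:R * ln (n%:R * (1 + T%:R))).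
Proof.
exists 7 => n T C Y T0 hC dY1 recY r s r1 rs sT U dU.
(* In dimension 0 every trace is 0, so no density matrix exists. *)
have n0 : (0 < n)%N.
  case: n C Y hC dY1 recY U dU => // C Y _ [_ /eqP]; rewrite /mxtrace big_ord0.
  by rewrite eq_sym oner_eq0.
rewrite -sumrB; apply: regret_bound => // t tT; last by have [_ []] := hC t tT.
by have [_ []] := hC t tT; rewrite /loewner_le subr0.
Qed.
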